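(* Piecewise linear unavoidable sections in $\mathbb{T}^3$ exist.
   Context: Let $\mathbb{T}^3=\mathbb{R}^3/\mathbb{Z}^3$ with projection $\pi:\mathbb{R}^3\to\mathbb{T}^3$. A subspace of $\mathbb{R}^3$ is rational if it is the solution set of a system of linear equations with rational coefficients. A set $\mathcal{S}\subset\mathbb{T}^3$ is a piecewise linear unavoidable section if (1) $\mathcal{S}=J_1\cup\dots\cup J_\ell$ where the $J_i$ are pairwise disjoint images under $\pi$ of closed line segments of finite length in $\mathbb{R}^3$, and (2) $\mathcal{S}\cap\pi(\bm{x}+Q)\neq\varnothing$ for every $\bm{x}\in\mathbb{R}^3$ and every 2-dimensional rational subspace $Q\subset\mathbb{R}^3$. *)

(* Defs.v *)
From HB Require Import structures.
From mathcomp Require Import all_boot all_order all_algebra.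
From mathcomp Require Import generic_quotient ring_quotient.
From mathcomp Require Import boolp classical_sets reals.

Set Implicit Arguments.
Unset Strict Implicit.
Unset Printing Implicit Defensive.

Import Order.TTheory GRing.Theory Num.Theory.

Local Open Scope ring_scope.
Local Open Scope classical_set_scope.

Section UnavoidableSections.

Variable R : realType.

Definition int_lattice (n : nat) : {pred 'rV[R]_n} :=
  fun x => [forall i, x 0 i \is a Num.int].

Fact int_lattice_zmod_closed (n : nat) : zmod_closed (@int_lattice n).
Proof.
split=> [|x y /forallP xZ /forallP yZ]; apply/forallP=> i; rewrite !mxE.
  exact: rpred0.
by rewrite rpredB ?xZ ?yZ.
Qed.

HB.instance Definition _ (n : nat) :=
  GRing.isZmodClosed.Build 'rV[R]_n (@int_lattice n)
    (@int_lattice_zmod_closed n).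

Definition torus (n : nat) := Quotient.quot (@int_lattice n).

Definition torus_proj (n : nat) (x : 'rV[R]_n) : torus n :=
  (\pi_(torus n) x)%qT.

Definition line_segment (n : nat) (a b : 'rV[R]_n) : set 'rV[R]_n :=
  [set (1 - t) *: a + t *: b | t in [set t : R | 0 <= t <= 1]].

Definition affine_translate (n : nat) (x : 'rV[R]_n) (Q : {vspace 'rV[R]_n}) :
    set 'rV[R]_n :=
  [set x + q | q in [set q | q \in Q]].

(* The rows of A are the coefficients of the equations. *)
Definition rational_subspace (n : nat) (Q : {vspace 'rV[R]_n}) : Prop :=
  exists (m : nat) (A : 'M[rat]_(m, n)),
    forall x : 'rV[R]_n, x \in Q <-> map_mx ratr A *m x^T = 0.

Definition finite_disjoint_segments (S : set (torus 3)) : Prop :=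
  exists (l : nat) (a b : 'I_l -> 'rV[R]_3),
    let J i := @torus_proj 3 @` line_segment (a i) (b i) in
    [/\ forall i, a i != b i,
        forall i j, i != j -> J i `&` J j = set0 &
        S = \bigcup_(i in [set: 'I_l]) J i].

Definition PL_unavoidable_section (S : set (torus 3)) : Prop :=
  finite_disjoint_segments S /\
  forall (x : 'rV[R]_3) (Q : {vspace 'rV[R]_3}),
    rational_subspace Q -> \dim Q = 2%N ->
    S `&` @torus_proj 3 @` affine_translate x Q !=set0.

End UnavoidableSections.

(* Main.v *)
Require Import Defs.
From mathcomp Require Import all_boot all_order all_algebra.
From mathcomp Require Import generic_quotient ring_quotient.
From mathcomp Require Import boolp classical_sets reals.

(** Three pairwise disjoint closed geodesics in the coordinate directions
    suffice. A plane [Q] misses some basis vector [e_i], so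
    [R^3 = Q + R e_i] and every translate of [Q] meets the full line in
    direction [e_i] covering the i-th geodesic. *)

Set Implicit Arguments.
Unset Strict Implicit.
Unset Printing Implicit Defensive.

Import Order.TTheory GRing.Theory Num.Theory.

Local Open Scope ring_scope.
Local Open Scope classical_set_scope.

Lemma torus_proj_eq (R : realType) (n : nat) (x y : 'rV[R]_n) :
  torus_proj x = torus_proj y <-> forall i, x 0 i - y 0 i \is a Num.int.
Proof.
have -> : (torus_proj x = torus_proj y) <-> x - y \in @int_lattice R n.
  by rewrite Quotient.idealrBE; split=> [/eqP|/eqP].
split=> [/forallP xy i|xy]; first by have := xy i; rewrite !mxE.
by apply/forallP => i; rewrite !mxE.
Qed.

(** If every basis vector lay in [Q], so would all their linear combinations, and [Q] would be the
    full space, of dimension [n]. *)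
Lemma exists_delta_notin (K : fieldType) (n : nat) (Q : {vspace 'rV[K]_n}) :
  (\dim Q < n)%N -> exists i, delta_mx 0 i \notin Q.
Proof.
move=> dimQ; apply/existsP; rewrite -negb_forall; apply/negP => /forallP eQ.
suff QT : Q = fullv by move: dimQ; rewrite QT dimvf /dim /= mul1n ltnn.
apply/eqP; rewrite eqEsubv subvf /=; apply/subvP => v _.
by rewrite (row_sum_delta v); apply: memv_suml => i _; apply: memvZ; exact: eQ.
Qed.

(** Adjoining a vector outside [Q] raises the dimension, which already fills the space; [s] is the
    coefficient of [e] in a decomposition of [y]. *)
Lemma hyperplane_add_line (K : fieldType) (vT : vectType K) (Q : {vspace vT})
    (e : vT) :
  \dim {:vT} = (\dim Q).+1 -> e \notin Q ->
  forall y, exists s, y - s *: e \in Q.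
Proof.
move=> dimT eQ y.
have QeT : (Q + <[e]>)%VS = fullv.
  apply/eqP; rewrite eqEdim subvf /= dimT.
  have: (\dim Q < \dim (Q + <[e]>))%N; last by [].
  rewrite ltnNge; apply: contra eQ => le_dim.
  have /eqP -> : Q == (Q + <[e]>)%VS by rewrite eqEdim addvSl.
  by apply: (subvP (addvSr _ _)); exact: memv_line.
have /memv_addP[q qQ [_ /vlineP[s ->] ->]] : y \in (Q + <[e]>)%VS.
  by rewrite QeT memvf.
by exists s; rewrite addrK.
Qed.

Section CoordinateCircles.

Variable R : realType.

(* Indices are taken modulo 3. For [j = i + 1] the circles [i] and [j] are
   told apart by the coordinate [i - 1 = j + 1], on which they take the
   values [1/2] and [0]. *)
Definition circle_base (i : 'I_3) : 'rV[R]_3 := 2^-1 *: delta_mx 0 (i - 1).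

(** The endpoints differ by a lattice vector, so the segment closes up in the torus. *)
Definition circle (i : 'I_3) : set (torus R 3) :=
  @torus_proj R 3 @`
    line_segment (circle_base i) (circle_base i + delta_mx 0 i).

Lemma circleP (i : 'I_3) (z : torus R 3) :
  circle i z <-> exists2 t : R, 0 <= t <= 1 &
    z = torus_proj (circle_base i + t *: delta_mx 0 i).
Proof.
have seg t : (1 - t) *: circle_base i + t *: (circle_base i + delta_mx 0 i)
    = circle_base i + t *: delta_mx 0 i.
  by rewrite scalerDr addrA -scalerDl subrK scale1r.
split=> [[_ [t t01 <-] <-]|[t t01 ->]]; first by exists t; rewrite ?seg.
by exists (circle_base i + t *: delta_mx 0 i) => //; exists t.
Qed.

Lemma half_notin_int : (2^-1 : R) \isn't a Num.int.
Proof.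
apply/negP => /norm_intr_ge1; rewrite invr_eq0 pnatr_eq0 => /(_ isT).
by rewrite ger0_norm ?invr_ge0 ?ler0n // leNgt invf_lt1 ?ltr0n ?ltr1n.
Qed.

Lemma circle_succ_disjoint (i : 'I_3) : circle i `&` circle (i + 1) = set0.
Proof.
apply/seteqP; split=> // z [/circleP[t _ ->] /circleP[u _ /torus_proj_eq]].
move=> /(_ (i - 1)); apply/negP; rewrite !mxE !eqxx addrK.
have -> : (i - 1 == i) = false by case: i => -[|[|[|]]].
have -> : (i - 1 == i + 1) = false by case: i => -[|[|[|]]].
by rewrite mulr1 !mulr0 !addr0 subr0 half_notin_int.
Qed.

(** Distinct residues modulo 3 differ by 1 or -1, so up to symmetry the two circles are
    consecutive. *)
Lemma circle_disjoint (i j : 'I_3) : i != j -> circle i `&` circle j = set0.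
Proof.
move=> ij; have /orP[/eqP->|/eqP->] : (j == i + 1) || (i == j + 1).
- by case: i j ij => -[|[|[|//]]] ? [] [|[|[|//]]].
- exact: circle_succ_disjoint.
- by rewrite setIC circle_succ_disjoint.
Qed.

Lemma circle_meets_plane (i : 'I_3) (x : 'rV[R]_3) (Q : {vspace 'rV[R]_3}) :
  \dim Q = 2%N -> delta_mx 0 i \notin Q ->
  circle i `&` @torus_proj R 3 @` affine_translate x Q !=set0.
Proof.
move=> dimQ eQ; have dimT : \dim {:'rV[R]_3} = (\dim Q).+1.
  by rewrite dimvf dimQ.
(* Decomposing [circle_base i - x] puts [x + q] on the line through [circle_base i] in direction
   [delta_mx 0 i], at parameter [- s]. *)
have [s] := hyperplane_add_line dimT eQ (circle_base i - x).
(* The fractional part of [- s] names the same point of the torus and lies in the parameter range of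
   the segment. *)
set q := _ - _ => qQ; pose t := - s - (Num.floor (- s))%:~R.
have t01 : 0 <= t <= 1.
  rewrite subr_ge0 floor_le /= lerBlDl addrC ltW //.
  by rewrite -[1]/(1%:~R) -intrD addrC floorD1_gt.
exists (torus_proj (x + q)); split; last first.
  by exists (x + q) => //; exists q.
apply/circleP; exists t => //; apply/torus_proj_eq => j.
have -> : x + q = circle_base i - s *: delta_mx 0 i.
  by rewrite /q addrA subrKC.
(* The difference reduces to the floor of [- s] times an entry equal to 0 or 1. *)
rewrite !mxE opprD addrACA subrr add0r /t mulrBl mulNr opprB opprK addrC addrK.
by rewrite rpredM ?intr_int ?rpred_nat.
Qed.

End CoordinateCircles.

Theorem theorem2p4 (R : realType) :
  exists S : set (torus R 3), PL_unavoidable_section S.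
Proof.
exists (\bigcup_(i in [set: 'I_3]) @circle R i); split.
  exists 3%N, (@circle_base R), (fun i => circle_base R i + delta_mx 0 i).
  split=> // [i|]; last exact: circle_disjoint.
  rewrite -subr_eq0 opprD addNKr oppr_eq0; apply/eqP => /matrixP/(_ 0 i)/eqP.
  by rewrite !mxE !eqxx oner_eq0.
move=> x Q _ dimQ.
have [|i eQ] := @exists_delta_notin _ _ Q; first by rewrite dimQ.
have [z [iz xz]] := circle_meets_plane x dimQ eQ.
by exists z; split=> //; exists i.
Qed.
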